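(* The linear map $\Phi:\mathcal{P}\to\widetilde{\mathcal{R}}$ defined on posets by $$\Phi(P)=\sum_{\omega\in\mathrm{Rev}(P)}\mathrm{Comp}(P,\omega)$$ is an algebra morphism such that $\zeta_1(P)=\chi(\Phi(P))$ for every poset $P$.
   Context: $\mathbf{k}$ is a field of characteristic $0$. $\mathcal{P}=\bigoplus_{n\ge0}\mathcal{P}_n$, where $\mathcal{P}_n$ is the $\mathbf{k}$-span of all partial orders on $[n]$; the product of a poset $P$ on $[m]$ and a poset $Q$ on $[n]$ is their ordinal sum $PQ$ on $[m+n]$: $x\le_{PQ}y$ iff $x\le_Py$ for $x,y\in[m]$; $x+m\le_{PQ}y+m$ iff $x\le_Qy$ for $x,y\in[n]$; and $x\le_{PQ}y$ for all $x\in[m]$, $y\in\{m+1,\dots,m+n\}$. The unit is the empty poset. A mountain is a finite poset with a unique maximal element that is above all other elements. $\widetilde{\mathcal{R}}$ is the $\mathbf{k}$-vector space with basis the isomorphism classes of finite mountains; it is an algebra with product the Cartesian product of posets and unit the one-element poset. For a mountain $M$ and $p\in M$, the depth $d(p)$ is the length (number of steps) of a longest chain in $\{q\in M\mid p\le q\}$, and $\chi:\widetilde{\mathcal{R}}\to\mathbf{k}$ is the linear map with $\chi(M)=\sum_{p\in M}(-1)^{d(p)}$. For a poset $P$ with $n$ elements, a $P$-listing is a list $\omega=(\omega_1,\dots,\omega_n)$ of all elements of $P$ without repetition; it is a linear extension if there are no $i<j$ with $\omega_j\le_P\omega_i$. For a composition $\alpha=(\alpha_1,\dots,\alpha_k)$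 of $n$, let $\mathrm{set}(\alpha)=\{\alpha_1,\alpha_1+\alpha_2,\dots,\alpha_1+\cdots+\alpha_{k-1}\}\subseteq[n-1]$. $\alpha$ is compatible with $\omega$ if the consecutive segments $(\omega_1,\dots,\omega_{\alpha_1}),\dots,(\omega_{\alpha_1+\cdots+\alpha_{k-1}+1},\dots,\omega_n)$ are linear extensions of the induced subposets on their elements. $\mathrm{Comp}(P,\omega)$ is the collection of all $\mathrm{set}(\alpha)$ with $\alpha$ compatible with $\omega$, ordered by inclusion; it is closed under supersets in $2^{[n-1]}$, so it is a mountain with maximal element $[n-1]$. $\omega$ is $P$-reversing if the union of the inclusion-minimal sets in $\mathrm{Comp}(P,\omega)$ equals $[n-1]$; $\mathrm{Rev}(P)$ is the set of $P$-reversing listings. For the empty poset ($n=0$), $[n-1]=\emptyset$, $\mathrm{Comp}=\{\emptyset\}$ for the empty listing, which is reversing. $\zeta_1:\mathcal{P}\to\mathbf{k}$ is the linear map with $\zeta_1(P)=\sum_{\omega\in\mathrm{Rev}(P)}\chi(\mathrm{Comp}(P,\omega))$. *)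

(* Defs.v *)
From HB Require Import structures.
From mathcomp Require Import all_boot all_order all_algebra.
From mathcomp Require Import finmap monalg.

Set Implicit Arguments.
Unset Strict Implicit.
Unset Printing Implicit Defensive.

Import GRing.Theory.
Local Open Scope ring_scope.
Local Open Scope quotient_scope.

Section FreeModule.
Variables (k : nzRingType) (B : choiceType) (V : lmodType k) (f : B -> V).

(* The linear extension of f : B -> V to the free module with basis B. *)
Definition linext (g : {malg k[B]}) : V := \sum_(b <- msupp g) g@_b *: f b.

Lemma linextEw (D : {fset B}) (g : {malg k[B]}) :
  fsubset (msupp g) D -> linext g = \sum_(b <- D) g@_b *: f b.
Proof.
move=> sD; rewrite /linext (big_fset_incl _ sD) //= => b _ gb.
by rewrite mcoeff_outdom // scale0r.
Qed.

Fact linext_is_linear : linear linext.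
Proof.
move=> c g h; pose D := (msupp g `|` msupp h `|` msupp (c *: g + h))%fset.
have sg : fsubset (msupp g) D.
  by apply/fsubsetP=> b gb; rewrite /D !in_fsetE gb.
have sh : fsubset (msupp h) D.
  by apply/fsubsetP=> b hb; rewrite /D !in_fsetE hb orbT.
have sgh : fsubset (msupp (c *: g + h)) D by apply: fsubsetUr.
rewrite (linextEw sg) (linextEw sh) (linextEw sgh).
rewrite scaler_sumr -big_split; apply: eq_bigr => b _ /=.
by rewrite mcoeffD mcoeffZ scalerDl scalerA.
Qed.

HB.instance Definition _ := GRing.isLinear.Build k {malg k[B]} V _ linext
  linext_is_linear.

Lemma linextU (b : B) : linext << b >> = f b.
Proof.
rewrite (@linextEw [fset b]%fset) ?msuppU_le //.
by rewrite big_seq_fset1 mcoeffUU scale1r.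
Qed.

End FreeModule.

Section Relations.
Variables (T : finType) (r : rel T).

Definition partial_order : bool :=
  [&& [forall x, r x x],
      [forall x, forall y, r x y && r y x ==> (x == y)] &
      [forall x, forall y, forall z, r x y && r y z ==> r x z]].

Lemma partial_orderP :
  reflect [/\ reflexive r, antisymmetric r & transitive r] partial_order.
Proof.
apply: (iffP and3P) => -[rr ra rt]; split.
- by move=> x; apply: (forallP rr).
- by move=> x y rxy; apply/eqP; move/forallP/(_ x)/forallP/(_ y): ra; rewrite rxy.
- move=> y x z rxy ryz; move/forallP/(_ x)/forallP/(_ y)/forallP/(_ z): rt.
  by rewrite rxy ryz.
- by apply/forallP.
- by apply/forallP=> x; apply/forallP=> y; apply/implyP=> /ra ->.
- apply/forallP=> x; apply/forallP=> y; apply/forallP=> z.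
  by apply/implyP=> /andP[]; apply: rt.
Qed.

Definition maximal_elt (t : T) : bool := [forall x, r t x ==> (x == t)].

Definition is_mountain : bool :=
  partial_order &&
  [exists t, [forall x, maximal_elt x == (x == t)] && [forall x, r x t]].

Lemma is_mountainP :
  reflect (partial_order /\ exists t, forall x, r x t) is_mountain.
Proof.
apply: (iffP andP) => -[po].
  by case/existsP=> t /andP[_ /forallP rt]; split=> //; exists t.
case=> t rt; split=> //; apply/existsP; exists t; apply/andP; split; last first.
  exact/forallP.
have [_ ra _] := partial_orderP po.
apply/forallP=> x; apply/eqP; apply/idP/eqP => [/forallP/(_ t)|->].
  by rewrite rt => /eqP.
by apply/forallP=> y; apply/implyP=> rty; apply/eqP/ra; rewrite rt.
Qed.

Definition is_chain (C : {set T}) : bool :=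
  [forall x in C, forall y in C, r x y || r y x].

Lemma is_chainP (C : {set T}) :
  reflect {in C &, forall x y, r x y || r y x} (is_chain C).
Proof.
apply: (iffP forall_inP) => [h x y xC yC|h x xC].
  by have /forall_inP/(_ y yC) := h x xC.
by apply/forall_inP=> y yC; apply: h.
Qed.

(* A chain with c elements has c - 1 steps. *)
Definition depth (p : T) : nat :=
  (\max_(C : {set T} | is_chain C && (C \subset [set q | r p q])) #|C|).-1.

Definition chi_rel (k : nzRingType) : k := \sum_(p : T) (-1) ^+ depth p.

End Relations.

Definition isomorphic (T U : finType) (r : rel T) (s : rel U) : bool :=
  [exists f : {ffun T -> U}, exists g : {ffun U -> T},
    [&& [forall x, g (f x) == x], [forall y, f (g y) == y] &
        [forall x, forall y, s (f x) (f y) == r x y]]].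

Lemma isomorphicP (T U : finType) (r : rel T) (s : rel U) :
  reflect (exists f : T -> U, bijective f /\ forall x y, s (f x) (f y) = r x y)
          (isomorphic r s).
Proof.
apply: (iffP existsP).
  case=> f /existsP[g /and3P[/forallP fg /forallP gf /forallP fr]].
  exists f; split; first by exists g => x; apply/eqP.
  by move=> x y; move/forallP/(_ y)/eqP: (fr x).
case=> f [[g fg gf] fr]; exists (finfun f); apply/existsP; exists (finfun g).
apply/and3P; split; do ?[apply/forallP=> x]; rewrite ?ffunE ?fg ?gf //.
by apply/forallP=> y; rewrite !ffunE fr.
Qed.

Lemma isomorphic_refl (T : finType) (r : rel T) : isomorphic r r.
Proof. by apply/isomorphicP; exists id; split=> //; exists id. Qed.

Lemma isomorphic_sym (T U : finType) (r : rel T) (s : rel U) :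
  isomorphic r s -> isomorphic s r.
Proof.
case/isomorphicP=> f [[g fg gf] fr]; apply/isomorphicP.
by exists g; split=> [|x y]; [exists f | rewrite -fr !gf].
Qed.

Lemma isomorphic_trans (T U W : finType) (r : rel T) (s : rel U) (t : rel W) :
  isomorphic r s -> isomorphic s t -> isomorphic r t.
Proof.
case/isomorphicP=> f [bf fr] /isomorphicP[g [bg gr]]; apply/isomorphicP.
by exists (g \o f); split=> [|x y]; [apply: bij_comp | rewrite /= gr fr].
Qed.

Lemma isomorphic_mountain (T U : finType) (r : rel T) (s : rel U) :
  isomorphic r s -> is_mountain r -> is_mountain s.
Proof.
case/isomorphicP=> f [[g fg gf] fr] /is_mountainP[/partial_orderP[rr ra rt]].
have gr x y : r (g x) (g y) = s x y by rewrite -fr !gf.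
case=> t tP; apply/is_mountainP; split; last first.
  by exists (f t) => x; rewrite -gr fg.
apply/partial_orderP; split=> [x|x y|y x z]; rewrite -!gr //.
  by move/ra=> /(can_inj gf).
exact: rt.
Qed.

Lemma isomorphic_depth (T U : finType) (r : rel T) (s : rel U) f :
    bijective f -> (forall x y, s (f x) (f y) = r x y) ->
  forall p, depth s (f p) = depth r p.
Proof.
case=> g fg gf fr p; rewrite /depth; congr _.-1.
have fi := can_inj fg.
rewrite (reindex (fun C : {set T} => f @: C)) /=; last first.
  by exists (fun C : {set U} => g @: C) => C _; rewrite -imset_comp;
    rewrite (eq_imset _ (_ : _ =1 id)) ?imset_id //.
apply: eq_big => [C|C _]; last by rewrite card_imset.
congr (_ && _).
  apply/is_chainP/is_chainP => h x y.
    by move=> xC yC; have := h _ _ (imset_f f xC) (imset_f f yC); rewrite !fr.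
  by case/imsetP=> a aC ->; case/imsetP=> b bC ->; rewrite !fr h.
apply/subsetP/subsetP => h x.
  by move=> xC; have := h _ (imset_f f xC); rewrite !inE fr.
by case/imsetP=> y yC ->; have := h _ yC; rewrite !inE fr.
Qed.

Lemma isomorphic_chi (k : nzRingType) (T U : finType) (r : rel T) (s : rel U) :
  isomorphic r s -> chi_rel r k = chi_rel s k.
Proof.
case/isomorphicP=> f [bf fr]; rewrite /chi_rel [RHS](reindex f) /=; last first.
  by case: bf => g fg gf; exists g => x _.
by apply: eq_bigr => p _; rewrite (isomorphic_depth bf fr).
Qed.

(* A poset on [n] is a partial order on 'I_n, i in [n] being i - 1 in 'I_n. *)
Record porder_on (n : nat) := POrderOn {
  porder_graph : {ffun 'I_n * 'I_n -> bool};
  _ : partial_order (fun i j => porder_graph (i, j)) }.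

HB.instance Definition _ n := [isSub for @porder_graph n].
HB.instance Definition _ n := [Choice of porder_on n by <:].

Definition poset : Type := {n : nat & porder_on n}.
HB.instance Definition _ := Choice.on poset.

Definition psize (P : poset) : nat := tag P.
Definition ple (P : poset) : rel 'I_(psize P) :=
  fun i j => porder_graph (tagged P) (i, j).

Lemma ple_po P : partial_order (@ple P).
Proof. by case: P => n []. Qed.

Fact mk_poset_subproof n (r : rel 'I_n) :
  partial_order r -> partial_order (fun i j => [ffun p => r p.1 p.2] (i, j)).
Proof.
move=> /partial_orderP[rr ra rt]; apply/partial_orderP.
split=> [x|x y|y x z]; rewrite !ffunE //; [exact: ra | exact: rt].
Qed.

Definition mk_poset n (r : rel 'I_n) (po : partial_order r) : poset :=
  Tagged porder_on (POrderOn (mk_poset_subproof po)).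

Lemma mk_posetE n (r : rel 'I_n) (po : partial_order r) i j :
  @ple (mk_poset po) i j = r i j.
Proof. by rewrite /ple /= ffunE. Qed.

Lemma poset_eq (P Q : poset) (e : psize P = psize Q) :
  (forall i j, @ple P i j = @ple Q (cast_ord e i) (cast_ord e j)) -> P = Q.
Proof.
case: P Q e => [m P] [n Q] /= e; case: n / e Q => Q h.
congr existT; apply: val_inj; apply/ffunP=> -[i j].
by have := h i j; rewrite /ple /= !cast_ord_id.
Qed.

Definition ordinal_sum_rel m n (r : rel 'I_m) (s : rel 'I_n) : rel 'I_(m + n) :=
  fun x y => match split x, split y with
             | inl i, inl j => r i j
             | inr i, inr j => s i j
             | inl _, inr _ => true
             | inr _, inl _ => false
             end.

Lemma splitl m n (i : 'I_m) : split (lshift n i) = inl i.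
Proof. exact: (unsplitK (inl i)). Qed.
Lemma splitr m n (i : 'I_n) : split (rshift m i) = inr i.
Proof. exact: (unsplitK (inr i)). Qed.

Lemma shiftP m n (x : 'I_(m + n)) :
  (exists i, x = lshift n i) \/ (exists i, x = rshift m i).
Proof. by case: (split_ordP x) => i ->; [left | right]; exists i. Qed.

Fact ordinal_sum_po m n (r : rel 'I_m) (s : rel 'I_n) :
  partial_order r -> partial_order s -> partial_order (ordinal_sum_rel r s).
Proof.
move=> /partial_orderP[rr ra rt] /partial_orderP[sr sa st].
apply/partial_orderP; split=> [x|x y|y x z]; rewrite /ordinal_sum_rel.
- by case: (shiftP x) => -[i ->]; rewrite ?splitl ?splitr.
- case: (shiftP x) => -[i ->]; case: (shiftP y) => -[j ->];
    rewrite ?splitl ?splitr //.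
    by move/ra->.
  by move/sa->.
- case: (shiftP x) => -[i ->]; case: (shiftP y) => -[j ->];
    case: (shiftP z) => -[l ->]; rewrite ?splitl ?splitr //.
    exact: rt.
  exact: st.
Qed.

Definition ordinal_sum (P Q : poset) : poset :=
  mk_poset (ordinal_sum_po (ple_po P) (ple_po Q)).

Fact empty_po : partial_order (fun _ _ : 'I_0 => true).
Proof. by apply/partial_orderP; split=> -[]. Qed.

Definition empty_poset : poset := mk_poset empty_po.

Lemma ordinal_sumA : associative ordinal_sum.
Proof.
move=> P Q R; apply: (@poset_eq (ordinal_sum P (ordinal_sum Q R))
  (ordinal_sum (ordinal_sum P Q) R) (addnA _ _ _)) => x y.
rewrite !mk_posetE /ordinal_sum_rel.
have c1 (i : 'I_(psize P)) : cast_ord (addnA (psize P) (psize Q) (psize R))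
    (lshift _ i) = lshift _ (lshift _ i) by apply: val_inj.
have c2 (i : 'I_(psize Q)) : cast_ord (addnA (psize P) (psize Q) (psize R))
    (rshift _ (lshift _ i)) = lshift _ (rshift _ i) by apply: val_inj.
have c3 (i : 'I_(psize R)) : cast_ord (addnA (psize P) (psize Q) (psize R))
    (rshift _ (rshift _ i)) = rshift _ i by apply: val_inj; rewrite /= addnA.
have cs (z : 'I_(psize P + (psize Q + psize R))) :
    [\/ exists i, z = lshift _ i, exists i, z = rshift _ (lshift _ i)
      | exists i, z = rshift _ (rshift _ i)].
  case: (shiftP z) => -[i ->]; first by constructor 1; exists i.
  by case: (shiftP i) => -[j ->]; [constructor 2 | constructor 3]; exists j.
by case: (cs x) => -[i ->]; case: (cs y) => -[j ->];
rewrite ?c1 ?c2 ?c3 ?(splitl, splitr) ?mk_posetE /ordinal_sum_rel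
  ?(splitl, splitr).
Qed.

Lemma ordinal_sum0P : left_id empty_poset ordinal_sum.
Proof.
move=> P; apply: (@poset_eq (ordinal_sum empty_poset P) P (add0n _)) => x y.
rewrite mk_posetE /ordinal_sum_rel.
case: (shiftP x) => -[i ->]; first by case: i.
case: (shiftP y) => -[j ->]; first by case: j.
by rewrite !splitr; congr ple; apply: val_inj.
Qed.

Lemma ordinal_sumP0 : right_id empty_poset ordinal_sum.
Proof.
move=> P; apply: (@poset_eq (ordinal_sum P empty_poset) P (addn0 _)) => x y.
rewrite mk_posetE /ordinal_sum_rel.
case: (shiftP x) => -[i ->]; last by case: i.
case: (shiftP y) => -[j ->]; last by case: j.
by rewrite !splitl; congr ple; apply: val_inj.
Qed.

Lemma psize_eq0 P : psize P = 0%N -> P = empty_poset.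
Proof.
move=> e; apply: (@poset_eq P empty_poset e) => x.
by have := ltn_ord (cast_ord e x); rewrite ltn0.
Qed.

Lemma ordinal_sum_unit P Q :
  ordinal_sum P Q = empty_poset -> P = empty_poset /\ Q = empty_poset.
Proof.
move/(congr1 psize) => /= /eqP; rewrite addn_eq0 => /andP[/eqP p /eqP q].
by split; apply: psize_eq0.
Qed.

HB.instance Definition _ := Choice_isMonomialDef.Build poset
  ordinal_sumA ordinal_sum0P ordinal_sumP0 ordinal_sum_unit.

Notation poset_alg k := {malg k[poset]}.

(* Up to isomorphism every finite mountain lives on some 'I_n. *)
Record mountain_on (n : nat) := MountainOn {
  mountain_graph : {ffun 'I_n * 'I_n -> bool};
  _ : is_mountain (fun i j => mountain_graph (i, j)) }.

HB.instance Definition _ n := [isSub for @mountain_graph n].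
HB.instance Definition _ n := [Choice of mountain_on n by <:].

Definition mountain : Type := {n : nat & mountain_on n}.
HB.instance Definition _ := Choice.on mountain.

Definition mle (M : mountain) : rel 'I_(tag M) :=
  fun i j => mountain_graph (tagged M) (i, j).

Lemma mleP M : is_mountain (@mle M).
Proof. by case: M => n []. Qed.

Definition mountain_iso (M N : mountain) : bool :=
  isomorphic (@mle M) (@mle N).

Fact mountain_iso_refl : reflexive mountain_iso.
Proof. by move=> M; apply: isomorphic_refl. Qed.
Fact mountain_iso_sym : symmetric mountain_iso.
Proof. by move=> M N; apply/idP/idP; apply: isomorphic_sym. Qed.
Fact mountain_iso_trans : transitive mountain_iso.
Proof. by move=> N M L; apply: isomorphic_trans. Qed.

Canonical mountain_iso_equiv :=
  EquivRel mountain_iso mountain_iso_refl mountain_iso_sym mountain_iso_trans.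

Definition mountain_class := {eq_quot mountain_iso_equiv}.
HB.instance Definition _ := Choice.on mountain_class.
HB.instance Definition _ := EqQuotient.on mountain_class.

Section ClassOf.
Variables (T : finType) (r : rel T).

Definition enum_rel (i j : 'I_#|T|) : bool :=
  [ffun p : 'I_#|T| * 'I_#|T| => r (enum_val p.1) (enum_val p.2)] (i, j).

Lemma enum_rel_iso : isomorphic r enum_rel.
Proof.
apply/isomorphicP; exists enum_rank; split.
  by exists enum_val; [apply: enum_rankK | apply: enum_valK].
by move=> x y; rewrite /enum_rel ffunE /= !enum_rankK.
Qed.

Hypothesis rM : is_mountain r.

Definition mk_mountain : mountain :=
  Tagged mountain_on (MountainOn (isomorphic_mountain enum_rel_iso rM)).

(* The isomorphism class of an arbitrary finite mountain. *)
Definition class_of : mountain_class := \pi mk_mountain.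

Lemma class_of_repr : isomorphic r (@mle (repr class_of)).
Proof.
apply: isomorphic_trans enum_rel_iso _.
have /eqmodP : mk_mountain = repr class_of %[mod mountain_class].
  by rewrite /class_of reprK.
by [].
Qed.

End ClassOf.

Lemma class_ofP (T U : finType) (r : rel T) (s : rel U)
    (rM : is_mountain r) (sM : is_mountain s) :
  reflect (class_of rM = class_of sM) (isomorphic r s).
Proof.
apply: (iffP idP) => [rs|e].
  apply/eqmodP; apply: isomorphic_trans (enum_rel_iso s).
  exact: isomorphic_trans (isomorphic_sym (enum_rel_iso r)) rs.
apply: isomorphic_trans (class_of_repr rM) _.
by rewrite e; apply: isomorphic_sym (class_of_repr sM).
Qed.

Lemma class_of_mle (M : mountain_class) : class_of (mleP (repr M)) = M.
Proof.
rewrite -[RHS]reprK; apply/eqmodP; apply: isomorphic_sym.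
exact: enum_rel_iso.
Qed.

Definition prod_rel (T U : finType) (r : rel T) (s : rel U) : rel (T * U) :=
  fun x y => r x.1 y.1 && s x.2 y.2.

Fact prod_mountain (T U : finType) (r : rel T) (s : rel U) :
  is_mountain r -> is_mountain s -> is_mountain (prod_rel r s).
Proof.
case/is_mountainP=> /partial_orderP[rr ra rt] [t tP].
case/is_mountainP=> /partial_orderP[sr sa st] [u uP].
apply/is_mountainP; split; last first.
  by exists (t, u) => x; rewrite /prod_rel tP uP.
apply/partial_orderP; split=> [x|[x x'] [y y']|y x z]; rewrite /prod_rel /=.
- by rewrite rr sr.
- by rewrite andbACA => /andP[/ra -> /sa ->].
- by case/andP=> h1 h2 /andP[h3 h4]; rewrite (rt _ _ _ h1 h3) (st _ _ _ h2 h4).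
Qed.

Lemma isomorphic_prod (T T' U U' : finType) (r : rel T) (r' : rel T')
    (s : rel U) (s' : rel U') :
  isomorphic r r' -> isomorphic s s' ->
  isomorphic (prod_rel r s) (prod_rel r' s').
Proof.
case/isomorphicP=> f [[f' ff f'f] fr] /isomorphicP[g [[g' gg g'g] gr]].
apply/isomorphicP; exists (fun x => (f x.1, g x.2)); split.
  by exists (fun x => (f' x.1, g' x.2)) => -[x y] /=; congr pair.
by move=> x y; rewrite /prod_rel /= fr gr.
Qed.

Definition class_mul (M N : mountain_class) : mountain_class :=
  class_of (prod_mountain (mleP (repr M)) (mleP (repr N))).

Lemma class_mulE (T U : finType) (r : rel T) (s : rel U)
    (rM : is_mountain r) (sM : is_mountain s) :
  class_mul (class_of rM) (class_of sM) = class_of (prod_mountain rM sM).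
Proof.
by apply/class_ofP; apply: isomorphic_sym; apply: isomorphic_prod;
  apply: class_of_repr.
Qed.

Fact point_mountain : is_mountain (fun _ _ : unit => true).
Proof.
apply/is_mountainP; split; last by exists tt.
by apply/partial_orderP; split=> // -[] [].
Qed.

Definition class_one : mountain_class := class_of point_mountain.

Lemma class_mulA : associative class_mul.
Proof.
move=> L M N; rewrite -[L]class_of_mle -[M]class_of_mle -[N]class_of_mle.
rewrite !class_mulE; apply/class_ofP/isomorphicP.
exists (fun x => (x.1, x.2.1, x.2.2)); split.
  by exists (fun x => (x.1.1, (x.1.2, x.2))); [case=> ? [] | case=> -[]].
by move=> x y; rewrite /prod_rel /= andbA.
Qed.

Lemma class_mul1M : left_id class_one class_mul.
Proof.
move=> M; rewrite -[M]class_of_mle class_mulE; apply/class_ofP/isomorphicP.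
exists snd; split; last by move=> x y.
by exists (pair tt) => [[[]]|].
Qed.

Lemma class_mulM1 : right_id class_one class_mul.
Proof.
move=> M; rewrite -[M]class_of_mle class_mulE; apply/class_ofP/isomorphicP.
exists fst; split; last by move=> x y; rewrite /prod_rel andbT.
by exists (fun x => (x, tt)) => [[x []]|].
Qed.

Lemma class_of_eq1 (T : finType) (r : rel T) (rM : is_mountain r) :
  class_of rM = class_one <-> #|T| = 1%N.
Proof.
split=> [/class_ofP/isomorphicP[f [bf _]]|cT].
  by rewrite (bij_eq_card bf) card_unit.
apply/class_ofP/isomorphicP; exists (fun _ => tt).
have /fintype1P[t tP] : #|T| == 1%N by apply/eqP.
have [/partial_orderP[rr _ _] _] := is_mountainP _ rM.
split; first by exists (fun _ => t) => [x|[]//]; rewrite [RHS]tP.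
by move=> x y; rewrite [x]tP [y]tP rr.
Qed.

Lemma class_mul_unit M N :
  class_mul M N = class_one -> M = class_one /\ N = class_one.
Proof.
rewrite -[M]class_of_mle -[N]class_of_mle class_mulE => /class_of_eq1 /eqP.
rewrite card_prod muln_eq1 => /andP[/eqP m /eqP n].
by split; apply/class_of_eq1.
Qed.

HB.instance Definition _ := Choice_isMonomialDef.Build mountain_class
  class_mulA class_mul1M class_mulM1 class_mul_unit.

Notation mountain_alg k := {malg k[mountain_class]}.

Definition chi_class (k : nzRingType) (M : mountain_class) : k :=
  chi_rel (@mle (repr M)) k.

Lemma chi_classE (k : nzRingType) (T : finType) (r : rel T)
    (rM : is_mountain r) : chi_class k (class_of rM) = chi_rel r k.
Proof. exact: esym (isomorphic_chi k (class_of_repr rM)). Qed.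

Definition chi (k : nzRingType) : mountain_alg k -> k^o :=
  linext (chi_class k : mountain_class -> k^o).

Definition is_composition (n : nat) (a : seq nat) : bool :=
  all (fun i => 0 < i)%N a && (sumn a == n).

(* set(alpha), the element i of [n-1] being represented by i - 1 in 'I_n.-1. *)
Definition comp_set (n : nat) (a : seq nat) : {set 'I_n.-1} :=
  [set i : 'I_n.-1 | [exists j : 'I_(size a).-1, i.+1 == sumn (take j.+1 a)]].

Section Listings.
Variable P : poset.
Local Notation n := (psize P).

Definition linear_extension (s : seq 'I_n) : bool :=
  pairwise (fun x y => ~~ ple y x) s.

Definition compatible (w : n.-tuple 'I_n) (a : seq nat) : bool :=
  all linear_extension (reshape a w).

(* A composition of n has at most n parts, each at most n. *)
Definition Comp (w : n.-tuple 'I_n) : {set {set 'I_n.-1}} :=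
  [set comp_set n (map val a) | a : n.-bseq 'I_n.+1
     & is_composition n (map val a) && compatible w (map val a)].

Lemma CompP (w : n.-tuple 'I_n) (S : {set 'I_n.-1}) :
  reflect (exists a : seq nat,
             [/\ is_composition n a, compatible w a & S = comp_set n a])
          (S \in Comp w).
Proof.
apply: (iffP imsetP) => [[a]|[a [ca wa ->]]].
  by rewrite inE => /andP[ca wa] ->; exists (map val a).
have [a_gt0 /eqP an] := andP ca.
have le_size : (size a <= n)%N.
  rewrite -an; elim: a a_gt0 {ca wa an} => //= x a IH /andP[x0 /IH].
  by rewrite -add1n; apply: leq_add.
have le_part : all (fun i => i < n.+1)%N a.
  apply/allP=> x; rewrite ltnS -an; elim: (a) => //= y b IH.
  rewrite inE => /orP[/eqP->|/IH h]; first exact: leq_addr.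
  exact: leq_trans h (leq_addl _ _).
pose b : seq 'I_n.+1 := map inord a.
have bE : map val b = a.
  rewrite -map_comp map_id_in // => x /(allP le_part) xn.
  by rewrite /= inordK.
have sb : (size b <= n)%N by rewrite size_map.
by exists (Bseq sb); rewrite ?inE /= bE ?ca.
Qed.

Definition Comp_rel (w : n.-tuple 'I_n) : rel {S | S \in Comp w} :=
  fun x y => val x \subset val y.

Lemma setT_Comp (w : n.-tuple 'I_n) : setT \in Comp w.
Proof.
have sn m : sumn (nseq m 1%N) = m by rewrite sumn_nseq mul1n.
apply/CompP; exists (nseq n 1%N); split.
- by rewrite /is_composition sn eqxx andbT all_nseq orbT.
- apply/allP=> s /(nthP [::])[i]; rewrite size_reshape size_nseq => ltin <-.
  have : size (nth [::] (reshape (nseq n 1%N) w) i) = 1%N.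
    rewrite -(nth_map _ 0%N size) ?size_reshape ?size_nseq //.
    have -> : map size (reshape (nseq n 1%N) w) = nseq n 1%N.
      by apply: (@reshapeKl _ (nseq n 1%N)); rewrite sn size_tuple.
    by rewrite nth_nseq ltin.
  by case: (nth _ _ _) => [|x []].
- apply/setP=> i; rewrite !inE; apply/esym/existsP.
  have lti : (i < (size (nseq n 1%N)).-1)%N by rewrite size_nseq.
  exists (Ordinal lti); apply/eqP => /=.
  by rewrite take_nseq ?sn // (leq_trans (ltn_ord i)) // leq_pred.
Qed.

Fact Comp_mountain (w : n.-tuple 'I_n) : is_mountain (@Comp_rel w).
Proof.
apply/is_mountainP; split; last first.
  by exists (exist _ setT (setT_Comp w)) => x; apply: subsetT.
apply/partial_orderP; split=> [x|x y|y x z]; rewrite /Comp_rel //.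
- by rewrite -eqEsubset => /eqP/val_inj.
- exact: subset_trans.
Qed.

Definition Comp_class (w : n.-tuple 'I_n) : mountain_class :=
  class_of (Comp_mountain w).

Definition Rev : {set n.-tuple 'I_n} :=
  [set w : n.-tuple 'I_n |
    uniq w && (\bigcup_(S | minset (mem (Comp w)) S) S == setT)].

End Listings.

Definition Phi (k : nzRingType) : poset_alg k -> mountain_alg k :=
  linext (fun P : poset =>
    \sum_(w in Rev P) << Comp_class w >> : mountain_alg k).

Definition zeta1 (k : nzRingType) : poset_alg k -> k^o :=
  linext (fun P : poset =>
    \sum_(w in Rev P) chi << Comp_class w >> : k^o).

Lemma PhiE (k : nzRingType) (P : poset) :
  Phi << P >> = \sum_(w in Rev P) << Comp_class w >> :> mountain_alg k.
Proof. by rewrite /Phi /zeta1 linextU. Qed.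

Lemma chiE (k : nzRingType) (T : finType) (r : rel T) (rM : is_mountain r) :
  chi << class_of rM >> = \sum_(p : T) (-1) ^+ depth r p :> k.
Proof. by rewrite /chi linextU chi_classE. Qed.

Lemma zeta1E (k : nzRingType) (P : poset) :
  zeta1 << P >> = \sum_(w in Rev P) chi << Comp_class w >> :> k.
Proof. by rewrite /Phi /zeta1 linextU. Qed.

(* Main.v *)
Require Import Defs.
From HB Require Import structures.
From mathcomp Require Import all_boot all_order all_algebra.
From mathcomp Require Import finmap monalg zify.

(** A set of cuts belongs to [Comp P w] iff it separates every pair of positions
    i < j with w_j <= w_i.  In the ordinal sum PQ every element of Q lies above
    every element of P; a P-element immediately followed by a Q-element would
    give a cut that lies in no minimal set, so a reversing listing of PQ is a
    listing v of Q followed by a listing u of P.  The cut between the two blocks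
    is then forced and the remaining cuts are chosen independently in each
    block, so [Comp (PQ) (vu)] is isomorphic to [Comp P u] x [Comp Q v], minimal
    sets correspond to pairs of minimal sets, and vu is reversing iff u and v
    are.  Hence [Phi] is multiplicative on posets. *)

Set Implicit Arguments.
Unset Strict Implicit.
Unset Printing Implicit Defensive.

Import GRing.Theory.
Local Open Scope ring_scope.

(** * Compositions and sets of cuts *)

(** The sums [sumn (take k a)] are the block boundaries, so two positions share a block iff none of
    these sums falls between them. The induction peels off the first block. *)
Lemma all_pairwise_reshapeP (T : eqType) (x0 : T) (r : rel T) (a : seq nat)
    (s : seq T) : sumn a = size s ->
  (forall i j, (i < j < size s)%N ->
     (forall k, ~~ (i < sumn (take k a) <= j)%N) -> r (nth x0 s i) (nth x0 s j))
  <-> all (pairwise r) (reshape a s).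
Proof.
elim: a s => [|x a IH] s /=.
  by move=> /esym/size0nil -> ; split=> // _ i j /=; rewrite ltn0 andbF.
move=> size_s; have x_le : (x <= size s)%N by lia.
have size_drop_s : sumn a = size (drop x s) by rewrite size_drop; lia.
have [IHl IHr] := IH _ size_drop_s; split.
- move=> h; apply/andP; split.
    apply/(pairwiseP x0) => i j; rewrite !inE size_takel // => ix jx ij.
    rewrite !nth_take //; apply: h => [|[|k]]; first by lia.
      by rewrite take0.
    by move=> /=; lia.
  apply: IHl => i j; rewrite size_drop !nth_drop => ij hk.
  apply: h => [|[|k]]; [by lia | by rewrite take0 | rewrite /=].
  by have := hk k; lia.
- case/andP=> /(pairwiseP x0) hx hd i j ij hk.
  have [jx|xj] := ltnP j x.
    have ix : (i < x)%N by lia.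
    rewrite -(nth_take x0 ix) -(nth_take x0 jx).
    by apply: hx; rewrite ?inE ?size_takel //; lia.
  (* [k = 1] gives the end of the first block: since [j] lies beyond it, so does [i]. *)
  have := hk 1%N; rewrite /= take0 addn0 xj andbT -leqNgt => ix.
  rewrite -(subnKC xj) -(subnKC ix) -!nth_drop.
  apply: (IHr hd) => [|k]; first by rewrite size_drop; lia.
  by have := hk k.+1 => /=; lia.
Qed.

(** Induction on [n], with the cuts shifted down by one: prepend a part [1] if [1] is a cut,
    otherwise lengthen the first part by one. *)
Lemma composition_of_cuts (n : nat) (D : pred nat) : exists2 a : seq nat,
  is_composition n a &
  forall m, (0 < m < n)%N -> D m <-> exists k, m = sumn (take k a).
Proof.
elim: n D => [|[|n] IH] D.
- by exists [::] => // m; rewrite ltn0 andbF.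
- by exists [:: 1%N] => // m; lia.
have [[|x a] /andP[]//= /andP[x0 a0] /eqP xa cuts] := IH (fun m => D m.+1).
have [D1|D1] := boolP (D 1%N).
  exists [:: 1%N, x & a]; first by rewrite /is_composition /= x0 a0 -xa /= eqxx.
  move=> [|[|m]] mn //; first by split=> // _; exists 1%N.
  split.
    by case/cuts=> // k ->; exists k.+1.
  by case=> -[|k] //= [e]; apply/cuts => //; exists k; rewrite e.
exists (x.+1 :: a); first by rewrite /is_composition /= a0 addSn xa eqxx.
move=> [|[|m]] mn //.
  by split=> [/(negP D1)//|[[|k] //= ]]; lia.
split.
  by case/cuts=> // -[|k] //= e; exists k.+1; rewrite /= addSn -e.
case=> -[|k] //= [e]; apply/cuts => //; exists k.+1 => /=; lia.
Qed.

Lemma mem_comp_set (n : nat) (a : seq nat) (i : 'I_n.-1) :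
  is_composition n a ->
  i \in comp_set n a <-> exists k, i.+1 = sumn (take k a).
Proof.
case/andP=> _ /eqP an; rewrite inE; split.
  by case/existsP=> j /eqP ->; exists j.+1.
case=> -[|k]; first by rewrite take0.
move=> e; apply/existsP.
have hk : (k < (size a).-1)%N.
  (* Otherwise [take k.+1 a] is all of [a], with sum [n], while [i.+1 < n]. *)
  rewrite ltnNge; apply/negP => ka; move: e.
  by rewrite take_oversize ?an; have := ltn_ord i; lia.
by exists (Ordinal hk); apply/eqP.
Qed.

(* The cut [s] lies between the positions [s] and [s.+1]. *)
Definition separates (n : nat) (S : {set 'I_n.-1}) (i j : nat) : Prop :=
  exists2 s, s \in S & (i <= s < j)%N.

(** Compatibility means that no reversed pair lies in one block, and every set of cuts comes from a
    composition by [composition_of_cuts]. From here on [Comp] is handled without compositions. *)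
Lemma Comp_separatesP (P : poset) (w : (psize P).-tuple 'I_(psize P))
    (S : {set 'I_(psize P).-1}) :
  reflect (forall i j : 'I_(psize P), (i < j)%N -> ple (tnth w j) (tnth w i) ->
             separates S i j)
          (S \in Comp w).
Proof.
have compatibleP a : is_composition (psize P) a ->
    compatible w a <-> (forall i j : 'I_(psize P), (i < j)%N ->
      ple (tnth w j) (tnth w i) -> separates (comp_set (psize P) a) i j).
  move=> ca; have /andP[_ /eqP an] := ca.
  have e : sumn a = size w by rewrite size_tuple.
  split=> [comp_a i j ij wji|sep].
    have /all_pairwise_reshapeP - /(_ (tnth w i) e i j) := comp_a.
    rewrite size_tuple ij ltn_ord -!tnth_nth wji => /(_ isT) h.
    have [k] : exists k, (i < sumn (take k a) <= j)%N.
      (* Bounding [k] makes the existence decidable; beyond [size a] the sum is the full size, which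
         exceeds [j]. *)
      have /hasP[k _ hk] : has (fun k => i < sumn (take k a) <= j)%N
          (iota 0 (size a).+1); last by exists k.
      apply/negPn/negP => /hasPn nk; suff : false by [].
      apply: h => k.
      have [ka|ka] := leqP k (size a); first by apply: nk; rewrite mem_iota.
      by rewrite take_oversize ?an; have := ltn_ord j; lia.
    move=> hk; have lt_s : ((sumn (take k a)).-1 < (psize P).-1)%N.
      by have := ltn_ord j; lia.
    exists (Ordinal lt_s) => /=; last by lia.
    by apply/mem_comp_set => //; exists k => /=; lia.
  (* The empty poset has no element to serve as the default in [all_pairwise_reshapeP]. *)
  case: (posnP (psize P)) => [P0|P_gt0].
    move: w {sep} e; rewrite /compatible => -[s hs] /=.
    have -> : s = [::] by apply: size0nil; rewrite (eqP hs).
    by move=> _; elim: (a).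
  apply/(all_pairwise_reshapeP (Ordinal P_gt0) _ e) => i j.
  rewrite size_tuple => /andP[ij jn] nk.
  have iN : (i < psize P)%N by apply: ltn_trans jn.
  apply/negP => wji; have [] := sep (Ordinal iN) (Ordinal jn) ij.
    by rewrite !(tnth_nth (Ordinal P_gt0)).
  by move=> s /(mem_comp_set _ ca) [k hk] /= ?; have := nk k; lia.
apply: (iffP (CompP _ _)) => [[a [ca wa ->]]|sep]; first exact/compatibleP.
have [a ca cuts] := composition_of_cuts (psize P)
  (fun m => [exists s : 'I_(psize P).-1, (s \in S) && (s.+1 == m)]).
have aS : S = comp_set (psize P) a.
  apply/setP=> s; have /cuts cuts_s : (0 < s.+1 < psize P)%N.
    by have := ltn_ord s; lia.
  apply/idP/idP => [sS|/(mem_comp_set _ ca)/cuts_s/existsP[t]].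
    by apply/(mem_comp_set _ ca)/cuts_s/existsP; exists s; rewrite sS eqxx.
  by case/andP=> tS /eqP[/val_inj <-].
by exists a; split=> //; apply/(compatibleP _ ca); rewrite -aS.
Qed.

(** * Positions and cuts of two consecutive blocks *)

Section Blocks.
Variables m n : nat.

(** [m + n] is the size of the ordinal sum, but the block of size [n] is listed first; hence the
    cast along [addnC]. *)
Definition early_pos (i : 'I_n) : 'I_(m + n) :=
  cast_ord (addnC n m) (lshift m i).
Definition late_pos (i : 'I_m) : 'I_(m + n) :=
  cast_ord (addnC n m) (rshift n i).

Lemma block_posP (i : 'I_(m + n)) :
  (exists j, i = early_pos j) \/ (exists j, i = late_pos j).
Proof.
have -> : i = cast_ord (addnC n m) (cast_ord (addnC m n) i) by apply: val_inj.
by case: (shiftP (cast_ord (addnC m n) i)) => -[j ->]; [left | right]; exists j.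
Qed.

Fact early_cut_subproof (s : 'I_n.-1) : (s < (m + n).-1)%N.
Proof. by have := ltn_ord s; lia. Qed.
Definition early_cut (s : 'I_n.-1) : 'I_(m + n).-1 :=
  Ordinal (early_cut_subproof s).

Fact late_cut_subproof (s : 'I_m.-1) : (n + s < (m + n).-1)%N.
Proof. by have := ltn_ord s; lia. Qed.
Definition late_cut (s : 'I_m.-1) : 'I_(m + n).-1 :=
  Ordinal (late_cut_subproof s).

Lemma early_cut_inj : injective early_cut.
Proof. by move=> s t /(congr1 val) /= /val_inj. Qed.

Lemma late_cut_inj : injective late_cut.
Proof. by move=> s t /(congr1 val) /= /addnI /val_inj. Qed.

Lemma block_cutP (s : 'I_(m + n).-1) :
  [\/ s.+1 = n, exists t, s = early_cut t | exists t, s = late_cut t].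
Proof.
have lt_s := ltn_ord s.
have [sn|ns|sn] := ltngtP s.+1 n.
- have ltn : (s < n.-1)%N by lia.
  by constructor 2; exists (Ordinal ltn); apply: val_inj.
- have ltm : (s - n < m.-1)%N by lia.
  by constructor 3; exists (Ordinal ltm); apply: val_inj => /=; lia.
- by constructor 1.
Qed.

(* The cut [s] with [s.+1 = n] separates the blocks; there is none when [m] or
   [n] is [0]. *)
Definition join_cuts (T : {set 'I_m.-1}) (S : {set 'I_n.-1}) :
    {set 'I_(m + n).-1} :=
  [set s : 'I_(m + n).-1 | s.+1 == n]
    :|: (late_cut @: T :|: early_cut @: S).

Lemma mid_join (T : {set 'I_m.-1}) (S : {set 'I_n.-1}) (s : 'I_(m + n).-1) :
  s.+1 = n -> s \in join_cuts T S.
Proof. by move=> sn; rewrite !inE sn eqxx. Qed.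

Lemma early_join (T : {set 'I_m.-1}) (S : {set 'I_n.-1}) s :
  (early_cut s \in join_cuts T S) = (s \in S).
Proof.
rewrite !inE (mem_imset _ _ early_cut_inj) /=.
have -> : (s.+1 == n) = false by have := ltn_ord s; lia.
case: imsetP => // -[t _ /(congr1 val) /=]; have := ltn_ord s; lia.
Qed.

Lemma late_join (T : {set 'I_m.-1}) (S : {set 'I_n.-1}) s :
  (late_cut s \in join_cuts T S) = (s \in T).
Proof.
rewrite !inE (mem_imset _ _ late_cut_inj) /=.
have -> : ((n + s).+1 == n) = false by lia.
case: imsetP => [[t _ /(congr1 val) /=]|_]; last by rewrite orbF.
by have := ltn_ord t; lia.
Qed.

Lemma early_cutK (T : {set 'I_m.-1}) (S : {set 'I_n.-1}) :
  early_cut @^-1: join_cuts T S = S.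
Proof. by apply/setP=> s; rewrite inE early_join. Qed.

Lemma late_cutK (T : {set 'I_m.-1}) (S : {set 'I_n.-1}) :
  late_cut @^-1: join_cuts T S = T.
Proof. by apply/setP=> s; rewrite inE late_join. Qed.

(** The two preimages forget only the cut between the blocks, which [join_cuts] puts back; so it
    must already be in [X]. *)
Lemma join_cutsK (X : {set 'I_(m + n).-1}) :
  (forall s : 'I_(m + n).-1, s.+1 = n -> s \in X) ->
  join_cuts (late_cut @^-1: X) (early_cut @^-1: X) = X.
Proof.
move=> midX; apply/setP=> s; case: (block_cutP s) => [sn|[t ->]|[t ->]].
- by rewrite mid_join ?midX.
- by rewrite early_join inE.
- by rewrite late_join inE.
Qed.

Lemma join_cuts_subset (T T' : {set 'I_m.-1}) (S S' : {set 'I_n.-1}) :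
  (join_cuts T S \subset join_cuts T' S') = (T \subset T') && (S \subset S').
Proof.
apply/idP/andP => [sub|[subT subS]].
  by split; [rewrite -(late_cutK T S) -(late_cutK T' S')
           | rewrite -(early_cutK T S) -(early_cutK T' S')]; apply: preimsetS.
by apply: setUS; apply: setUSS; apply: imsetS.
Qed.

End Blocks.

Arguments early_cut m n s : clear implicits.
Arguments late_cut m n s : clear implicits.

(** * Reversing listings of an ordinal sum *)

Lemma RevP (R : poset) (w : (psize R).-tuple 'I_(psize R)) :
  reflect (uniq w /\
           forall s, exists2 S, minset (mem (Comp w)) S & s \in S)
          (w \in Rev R).
Proof.
rewrite inE; apply: (iffP andP) => -[uw cov]; split=> //.
  move=> s; have : s \in [set: 'I_(psize R).-1] by rewrite inE.
  by rewrite -(eqP cov) => /bigcupP[S minS sS]; exists S.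
apply/eqP/setP=> s; rewrite !inE; have [S minS sS] := cov s.
by apply/bigcupP; exists S.
Qed.

Section OrdinalSum.
Variables P Q : poset.
Local Notation m := (psize P).
Local Notation n := (psize Q).

Lemma ple_sumE (x y : 'I_(m + n)) :
  @ple (ordinal_sum P Q) x y = ordinal_sum_rel (@ple P) (@ple Q) x y.
Proof. exact: mk_posetE. Qed.

(* The elements of [Q], which lie above those of [P], are listed first. *)
Definition join_listing (u : m.-tuple 'I_m) (v : n.-tuple 'I_n) :
    (psize (ordinal_sum P Q)).-tuple 'I_(psize (ordinal_sum P Q)) :=
  [tuple match split (cast_ord (addnC m n) i) with
         | inl j => rshift m (tnth v j)
         | inr j => lshift n (tnth u j)
         end | i < m + n].

Lemma join_listing_early u v j :
  tnth (join_listing u v) (early_pos m j) = rshift m (tnth v j).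
Proof.
rewrite tnth_mktuple.
have -> : cast_ord (addnC m n) (early_pos m j) = lshift m j.
  exact: val_inj.
by rewrite Defs.splitl.
Qed.

Lemma join_listing_late u v j :
  tnth (join_listing u v) (late_pos n j) = lshift n (tnth u j).
Proof.
rewrite tnth_mktuple.
have -> : cast_ord (addnC m n) (late_pos n j) = rshift n j.
  exact: val_inj.
by rewrite Defs.splitr.
Qed.

Lemma join_listing_inj u u' v v' :
  join_listing u v = join_listing u' v' -> u = u' /\ v = v'.
Proof.
move=> e; split; apply: eq_from_tnth => j.
  by apply: (@lshift_inj m n); rewrite -(join_listing_late u v) e
    join_listing_late.
by apply: (@rshift_inj m n); rewrite -(join_listing_early u v) e
  join_listing_early.
Qed.

Lemma uniq_join_listing u v : uniq (join_listing u v) = uniq u && uniq v.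
Proof.
apply/tuple_uniqP/andP => [inj|[/tuple_uniqP inju /tuple_uniqP injv] i j].
  split; apply/tuple_uniqP => i j e; apply: val_inj; last first.
    by have /inj/(congr1 val) : tnth (join_listing u v) (early_pos m i) =
      tnth (join_listing u v) (early_pos m j) by rewrite !join_listing_early e.
  by have /inj/(congr1 val)/addnI : tnth (join_listing u v) (late_pos n i) =
    tnth (join_listing u v) (late_pos n j) by rewrite !join_listing_late e.
have [[i' ->]|[i' ->]] := block_posP i; have [[j' ->]|[j' ->]] := block_posP j;
  rewrite ?join_listing_early ?join_listing_late => /eqP;
  rewrite ?eq_lshift ?eq_rshift ?eq_lrshift ?eq_rlshift // => /eqP.
  by move/injv ->.
by move/inju ->.
Qed.

(** Pairs inside a block give the conditions for [u] and [v]. A pair across the blocks has an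
    element of [Q] before one of [P], so it is always reversed, and the cut between the blocks
    separates it. *)
Lemma mem_Comp_join u v (X : {set 'I_(m + n).-1}) :
  (X \in @Comp (ordinal_sum P Q) (join_listing u v)) <->
  [/\ forall s : 'I_(m + n).-1, s.+1 = n -> s \in X,
      late_cut m n @^-1: X \in Comp u & early_cut m n @^-1: X \in Comp v].
Proof.
split=> [/Comp_separatesP sep|[midX /Comp_separatesP su /Comp_separatesP sv]].
  split.
  - move=> s sn; have lt_s := ltn_ord s.
    (* The last early and the first late position form a reversed pair that only the cut between the
       blocks separates. *)
    have n1 : (n.-1 < n)%N by lia.
    have m0 : (0 < m)%N by lia.
    have [] := sep (early_pos m (Ordinal n1)) (late_pos n (Ordinal m0)).
    + by rewrite /=; lia.
    + rewrite join_listing_early join_listing_late ple_sumE /ordinal_sum_rel.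
      by rewrite Defs.splitl Defs.splitr.
    + by move=> t tX /= ht; suff -> : s = t by []; apply: val_inj => /=; lia.
  - apply/Comp_separatesP => i j ij uji.
    have [] : @separates (m + n) X (n + i) (n + j).
      apply: (sep (late_pos n i) (late_pos n j)); first by rewrite /=; lia.
      by rewrite !join_listing_late ple_sumE /ordinal_sum_rel !Defs.splitl.
    move=> s sX hs; have lt_s : (s - n < m.-1)%N by have := ltn_ord j; lia.
    exists (Ordinal lt_s) => /=; last by lia.
    rewrite inE; suff -> : late_cut m n (Ordinal lt_s) = s by [].
    by apply: val_inj => /=; lia.
  - apply/Comp_separatesP => i j ij vji.
    have [] : @separates (m + n) X i j.
      apply: (sep (early_pos m i) (early_pos m j)) => //.
      by rewrite !join_listing_early ple_sumE /ordinal_sum_rel !Defs.splitr.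
    move=> s sX hs; have lt_s : (s < n.-1)%N by have := ltn_ord j; lia.
    exists (Ordinal lt_s) => //=.
    rewrite inE; suff -> : early_cut m n (Ordinal lt_s) = s by [].
    exact: val_inj.
apply/Comp_separatesP => i j.
have [[i' ->]|[i' ->]] := block_posP i; have [[j' ->]|[j' ->]] := block_posP j;
  rewrite ?join_listing_early ?join_listing_late ple_sumE /ordinal_sum_rel
    ?Defs.splitl ?Defs.splitr /= => ij.
- move=> /(sv _ _ ij)[s]; rewrite inE => sX hs.
  by exists (early_cut m n s).
- move=> _; have lt_s : (n.-1 < (m + n).-1)%N.
    by have := ltn_ord i'; have := ltn_ord j'; lia.
  exists (Ordinal lt_s) => /=; last by have := ltn_ord i'; lia.
  by apply: midX => /=; have := ltn_ord i'; lia.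
- by have := ltn_ord j'; lia.
- have ij' : (i' < j')%N by lia.
  move=> /(su _ _ ij')[s]; rewrite inE => sX hs.
  by exists (late_cut m n s) => //=; lia.
Qed.

Lemma join_cuts_in_Comp u v (T : {set 'I_m.-1}) (S : {set 'I_n.-1}) :
  (join_cuts T S \in @Comp (ordinal_sum P Q) (join_listing u v)) =
  (T \in Comp u) && (S \in Comp v).
Proof.
apply/idP/andP => [/mem_Comp_join[]|[Tu Sv]].
  by rewrite late_cutK early_cutK.
by apply/mem_Comp_join; split; rewrite ?late_cutK ?early_cutK // => s;
  apply: mid_join.
Qed.

Lemma Comp_join_cutsK u v (X : {set 'I_(m + n).-1}) :
  X \in @Comp (ordinal_sum P Q) (join_listing u v) ->
  join_cuts (late_cut m n @^-1: X) (early_cut m n @^-1: X) = X.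
Proof. by case/mem_Comp_join=> midX _ _; apply: join_cutsK. Qed.

(** [join_cuts] identifies the product order with inclusion on the joined [Comp], and an element of
    a product is minimal iff both coordinates are. *)
Lemma minset_join_cuts u v (T : {set 'I_m.-1}) (S : {set 'I_n.-1}) :
  minset (mem (@Comp (ordinal_sum P Q) (join_listing u v))) (join_cuts T S) =
  minset (mem (Comp u)) T && minset (mem (Comp v)) S.
Proof.
apply/minsetP/andP; rewrite /= join_cuts_in_Comp.
  case=> /andP[Tu Sv] minTS; split; apply/minsetP; split=> // B /= Bw sub.
    have e : join_cuts B S = join_cuts T S.
      by apply: minTS;
        rewrite /= ?join_cuts_in_Comp ?join_cuts_subset ?Bw ?sub /=.
    by rewrite -(late_cutK B S) e late_cutK.
  have e : join_cuts T B = join_cuts T S.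
    by apply: minTS; rewrite /= ?join_cuts_in_Comp ?join_cuts_subset ?Tu ?subxx.
  by rewrite -(early_cutK T B) e early_cutK.
case=> /minsetP[/= Tu minT] /minsetP[/= Sv minS]; split; first exact/andP.
move=> X Xw; rewrite -(Comp_join_cutsK Xw) join_cuts_subset => /andP[subT subS].
by case/mem_Comp_join: Xw => _ uX vX; rewrite (minT _ uX) // (minS _ vX).
Qed.

(** By [minset_join_cuts], a cut inside a block is covered iff it is covered for that block alone;
    the cut between the blocks lies in every join. *)
Lemma Rev_join_listing u v :
  (join_listing u v \in Rev (ordinal_sum P Q)) = (u \in Rev P) && (v \in Rev Q).
Proof.
apply/RevP/andP.
  case; rewrite uniq_join_listing => /andP[uu uv] cov.
  split; apply/RevP; split=> // s.
    have [X minX sX] := cov (late_cut m n s).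
    have Xw := minsetp minX.
    exists (late_cut m n @^-1: X); last by rewrite inE.
    by move: minX; rewrite -{1}(Comp_join_cutsK Xw) minset_join_cuts => /andP[].
  have [X minX sX] := cov (early_cut m n s).
  have Xw := minsetp minX.
  exists (early_cut m n @^-1: X); last by rewrite inE.
  by move: minX; rewrite -{1}(Comp_join_cutsK Xw) minset_join_cuts => /andP[].
case=> /RevP[uu covu] /RevP[uv covv]; split.
  by rewrite uniq_join_listing uu.
(* Some minimal set of the other block is needed to complete a pair; one exists below [setT]. *)
have [T0 minT0 _] : {T | minset (mem (Comp u)) T & T \subset setT}.
  exact/minset_exists/setT_Comp.
have [S0 minS0 _] : {S | minset (mem (Comp v)) S & S \subset setT}.
  exact/minset_exists/setT_Comp.
move=> s; case: (@block_cutP m n s) => [sn|[t ->]|[t ->]].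
- exists (join_cuts T0 S0); last exact: mid_join.
  by rewrite minset_join_cuts minT0.
- have [S minS tS] := covv t.
  exists (join_cuts T0 S); last by rewrite early_join.
  by rewrite minset_join_cuts minT0.
- have [T minT tT] := covu t.
  exists (join_cuts T S0); last by rewrite late_join.
  by rewrite minset_join_cuts minT.
Qed.

(** [join_cuts] is the isomorphism from the product; its inverse takes preimages under [late_cut]
    and [early_cut]. *)
Lemma Comp_class_join u v :
  @Comp_class (ordinal_sum P Q) (join_listing u v) =
  class_mul (Comp_class u) (Comp_class v).
Proof.
rewrite class_mulE; apply/class_ofP/isomorphic_sym/isomorphicP.
have join_in (x : {T | T \in Comp u} * {S | S \in Comp v}) :
    join_cuts (val x.1) (val x.2)
      \in @Comp (ordinal_sum P Q) (join_listing u v).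
  by rewrite join_cuts_in_Comp (valP x.1) (valP x.2).
exists (fun x => exist (fun X => X \in @Comp (ordinal_sum P Q) _) _ (join_in x));
  split; last first.
  by move=> x y; rewrite /Comp_rel /prod_rel /= join_cuts_subset.
have late_in (X : {X | X \in @Comp (ordinal_sum P Q) (join_listing u v)}) :
    late_cut m n @^-1: val X \in Comp u by case/mem_Comp_join: (valP X).
have early_in (X : {X | X \in @Comp (ordinal_sum P Q) (join_listing u v)}) :
    early_cut m n @^-1: val X \in Comp v by case/mem_Comp_join: (valP X).
exists (fun X => (exist (fun T => T \in Comp u) _ (late_in X),
                  exist (fun S => S \in Comp v) _ (early_in X))).
  by case=> T S; congr pair; apply: val_inj; rewrite /= ?late_cutK ?early_cutK.
by move=> X; apply: val_inj; apply: (Comp_join_cutsK (valP X)).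
Qed.

(* If an element of [P] came immediately before one of [Q], the block ending
   there would lie in [P] and the next one in [Q], so this cut could be removed
   from any set of cuts in [Comp w], hence would be in no minimal one. *)
Lemma Rev_no_ascent (w : (m + n).-tuple 'I_(m + n)) (i j : 'I_(m + n))
    (x : 'I_m) (y : 'I_n) :
  w \in Rev (ordinal_sum P Q) -> j = i.+1 :> nat ->
  tnth w i = lshift n x -> tnth w j = rshift m y -> False.
Proof.
case/RevP=> _ cov ji wi wj.
have lt_i : (i < (m + n).-1)%N by have := ltn_ord j; lia.
have [S minS iS] := cov (Ordinal lt_i).
suff S'w : S :\ Ordinal lt_i \in @Comp (ordinal_sum P Q) w.
  have e := minsetinf minS S'w (subD1set _ _).
  by move: iS; rewrite -e !inE eqxx.
have /Comp_separatesP sep : S \in @Comp (ordinal_sum P Q) w := minsetp minS.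
have {}sep (a b : 'I_(m + n)) : (a < b)%N ->
    ordinal_sum_rel (@ple P) (@ple Q) (tnth w b) (tnth w a) ->
    @separates (m + n) S a b.
  by move=> ab; rewrite -ple_sumE; apply: sep.
suff sep' (a b : 'I_(m + n)) : (a < b)%N ->
    ordinal_sum_rel (@ple P) (@ple Q) (tnth w b) (tnth w a) ->
    @separates (m + n) (S :\ Ordinal lt_i) a b.
  by apply/Comp_separatesP => a b ab; rewrite ple_sumE; apply: sep'.
move=> ab wba; have [s sS asb] := sep _ _ ab wba.
have [es|ns] := eqVneq s (Ordinal lt_i); last by exists s; rewrite // !inE ns.
move/(congr1 val): es asb => /= -> /andP[ai ib].
(* A pair inside [[a, b]] on one side of the cut at [i] is separated by another cut, which then
   separates [a] and [b] too. *)
have sub a' b' : (a <= a')%N -> (b' <= b)%N -> (i < a')%N || (b' <= i)%N ->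
    @separates (m + n) S a' b' ->
    @separates (m + n) (S :\ Ordinal lt_i) a b.
  move=> aa bb hi [t tS ht]; exists t; last by lia.
  by rewrite !inE tS andbT; apply/eqP => /(congr1 val) /=; lia.
(* If [w_a] is in [Q], the pair [(a, i)] is reversed, as [w_i] is in [P]. *)
case: (shiftP (tnth w a)) => -[x' wa]; last first.
  have ai' : (a < i)%N.
    rewrite ltn_neqAle ai andbT; apply/eqP => /val_inj e.
    by move: wa; rewrite e wi => /eqP; rewrite eq_lrshift.
  apply: (sub a i) => //; rewrite ?leqnn ?orbT //; first by lia.
  by apply: sep => //; rewrite wi wa /ordinal_sum_rel Defs.splitl Defs.splitr.
(* Now [w_a] is in [P], hence so is [w_b] below it, and [(j, b)] is reversed, as [w_j] is in [Q]. *)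
case: (shiftP (tnth w b)) => -[y' wb]; last first.
  by move: wba; rewrite wa wb /ordinal_sum_rel Defs.splitl Defs.splitr.
have jb : (j < b)%N.
  rewrite ltn_neqAle ji ib andbT; apply/eqP; rewrite -ji => /val_inj e.
  by move: wb; rewrite -e wj => /eqP; rewrite eq_rlshift.
apply: (sub j b) => //; rewrite ?ji ?leqnn //; first by lia.
by rewrite -ji; apply: sep => //;
  rewrite wj wb /ordinal_sum_rel Defs.splitl Defs.splitr.
Qed.

(** By [Rev_no_ascent] the set [A] of positions holding elements of [Q] is closed downwards; having
    [n] elements, it is the initial block [B]. *)
Lemma Rev_split (w : (m + n).-tuple 'I_(m + n)) :
  w \in Rev (ordinal_sum P Q) -> exists u v, w = join_listing u v.
Proof.
move=> wR; have [/tuple_uniqP w_inj _] := RevP _ wR.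
pose A := [set i | (m <= tnth w i)%N].
pose B := [set i : 'I_(m + n) | (i < n)%N].
have A_succ (i j : 'I_(m + n)) : j = i.+1 :> nat -> j \in A -> i \in A.
  rewrite !inE => ji jA; rewrite leqNgt; apply/negP => iA.
  case: (shiftP (tnth w i)) => -[x wi]; last by move: iA; rewrite wi /=; lia.
  case: (shiftP (tnth w j)) => -[y wj]; last exact: Rev_no_ascent wR ji wi wj.
  by move: jA; rewrite wj /= leqNgt ltn_ord.
have A_down d (i j : 'I_(m + n)) : j = (i + d)%N :> nat -> j \in A -> i \in A.
  elim: d j => [|d IH] j ji jA.
    by have <- : j = i by apply: val_inj; rewrite /= ji addn0.
  have lt_d : (i + d < m + n)%N by have := ltn_ord j; lia.
  by apply: (IH (Ordinal lt_d)) => //; apply: A_succ jA; rewrite /=; lia.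
have cardA : #|A| = n.
  rewrite (_ : A = tnth w @^-1: [set x : 'I_(m + n) | (m <= x)%N]); last first.
    by apply/setP=> i; rewrite !inE.
  rewrite card_preimset // (_ : [set x | _] = @rshift m n @: setT); last first.
    apply/setP=> x; rewrite inE; apply/idP/imsetP => [|[y _ ->]];
      last exact: leq_addr.
    case: (shiftP x) => -[y ->]; first by rewrite /= leqNgt ltn_ord.
    by exists y.
  by rewrite card_imset ?cardsT ?card_ord //; apply: rshift_inj.
have cardB : #|B| = n.
  rewrite (_ : B = @early_pos m n @: setT); last first.
    apply/setP=> x; rewrite inE; apply/idP/imsetP => [xn|[y _ ->]] //=.
    by exists (Ordinal xn) => //; apply: val_inj.
  rewrite card_imset ?cardsT ?card_ord // => x y /(congr1 val) /=.
  exact: val_inj.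
have AB : A = B.
  (* A position of [A] outside [B] would put all of [B] into [A], and the equal cardinalities settle
     this case as well. *)
  have [sub|/subsetPn[a aA]] := boolP (A \subset B).
    by apply/eqP; rewrite eqEcard sub cardA cardB leqnn.
  rewrite inE => an; apply/esym/eqP; rewrite eqEcard cardA cardB leqnn andbT.
  apply/subsetP=> b; rewrite inE => bn.
  by apply: (@A_down (a - b)%N b a _ aA); lia.
(* The default value [j] is never taken. *)
pose u := [tuple
  if split (tnth w (late_pos n j)) is inl x then x else j | j < m].
pose v := [tuple
  if split (tnth w (early_pos m j)) is inr y then y else j | j < n].
exists u, v; apply: eq_from_tnth => i; have /setP/(_ i) := AB.
rewrite !inE; have [[j ->]|[j ->]] := block_posP i.
  rewrite join_listing_early tnth_mktuple /= ltn_ord.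
  case: (shiftP (tnth w (early_pos m j))) => -[x ->]; rewrite ?Defs.splitr //=.
  by rewrite leqNgt ltn_ord.
rewrite join_listing_late tnth_mktuple /= [(_ + _ < n)%N]ltnNge leq_addr.
case: (shiftP (tnth w (late_pos n j))) => -[x ->]; rewrite ?Defs.splitl //=.
by rewrite leq_addr.
Qed.

End OrdinalSum.

Lemma Rev_ordinal_sum (P Q : poset) :
  Rev (ordinal_sum P Q) =
  [set join_listing x.1 x.2 | x in setX (Rev P) (Rev Q)].
Proof.
apply/setP=> w; apply/idP/imsetP => [wR|[[u v] uvR ->]].
  have [u [v e]] := Rev_split wR; exists (u, v) => //.
  by rewrite inE /= -Rev_join_listing -e.
by rewrite Rev_join_listing; move: uvR; rewrite inE.
Qed.

(** * Multiplicativity of [Phi] *)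

HB.instance Definition _ (k : nzRingType) := GRing.Linear.on (@Phi k).
HB.instance Definition _ (k : nzRingType) := GRing.Linear.on (@chi k).

Lemma malgU_scale (k : nzRingType) (B : choiceType) (c : k) (b : B) :
  << c *g b >> = c *: << b >>.
Proof. by apply/malgP => x; rewrite mcoeffZ !mcoeffU mulrnAr mulr1. Qed.

Lemma Phi_monomial (k : nzRingType) (c : k) (P : poset) :
  Phi << c *g P >> = \sum_(w in Rev P) << c *g Comp_class w >>.
Proof.
rewrite malgU_scale linearZ /= PhiE scaler_sumr.
by apply: eq_bigr => w _; rewrite [RHS]malgU_scale.
Qed.

(** The sum over pairs of reversing listings factors. The coefficients [c] and [d] match the terms
    in the expansion of a product of general elements. *)
Lemma Phi_ordinal_sum (k : nzRingType) (c d : k) (P Q : poset) :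
  Phi << c * d *g ordinal_sum P Q >> = Phi << c *g P >> * Phi << d *g Q >>.
Proof.
rewrite !Phi_monomial Rev_ordinal_sum big_imset /=; last first.
  by move=> [u v] [u' v'] _ _ /= /join_listing_inj[-> ->].
rewrite big_distrlr /= pair_big /=; apply: eq_big => [x|[u v] _] /=.
  by rewrite inE.
by rewrite malgM_def fgmulUU Comp_class_join.
Qed.

(** With no cuts to cover, the empty listing is reversing, and its [Comp] has a single element, so
    its class is the unit. *)
Lemma Phi_empty (k : nzRingType) :
  Phi << empty_poset >> = 1 :> {malg k[mountain_class]}.
Proof.
rewrite PhiE (_ : Rev empty_poset = [set [tuple]]); last first.
  apply/setP=> w; rewrite in_set1 tuple0 eqxx; apply/RevP; split=> //.
  by case.
rewrite big_set1 (_ : Comp_class _ = class_one) //.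
apply/class_of_eq1; rewrite card_sig -(cards1 (set0 : {set 'I_0})).
apply: eq_card => S; rewrite !inE.
have all0 (X : {set 'I_0}) : X = set0 by apply/setP=> -[].
by rewrite [S]all0 eqxx -(all0 setT) setT_Comp.
Qed.

Lemma Phi_monoid_morphism (k : nzRingType) : monoid_morphism (@Phi k).
Proof.
split=> [|g h]; first exact: Phi_empty.
(* Both sides expand over the posets supporting [g] and [h], and [Phi_ordinal_sum] compares them
   term by term. *)
rewrite malgME linear_sum [in RHS](monalgE g) [in RHS](monalgE h).
rewrite !linear_sum big_distrl; apply: eq_bigr => P _ /=.
rewrite big_distrr linear_sum; apply: eq_bigr => Q _ /=.
exact: Phi_ordinal_sum.
Qed.

Theorem theorem4p28 (k : fieldType) (char0 : [pchar k] =i pred0) :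
  [/\ linear (@Phi k),
      monoid_morphism (@Phi k) &
      forall P : poset, @zeta1 k << P >> = @chi k (@Phi k << P >>)].
Proof.
split; [exact: linearP | exact: Phi_monoid_morphism |].
by move=> P; rewrite PhiE zeta1E linear_sum.
Qed.
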